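(* Let $n\geq 8$ be an integer. Then $\Delta_D(A_n)^*$ is connected if and only if none of $n$, $n-1$, $n-2$ is a prime.
   Context: $A_n$ is the alternating group. The deep commuting graph $\Delta_D(G)$ has vertex set $G$, distinct vertices adjacent iff their preimages commute in a Schur cover $\tilde G$ of $G$ (a central extension $\{e\}\to M(G)\to\tilde G\to G\to\{e\}$ with kernel contained in $Z(\tilde G)\cap[\tilde G,\tilde G]$, of maximal order; $M(G)$ the Schur multiplier). A vertex is dominant if adjacent to every other vertex; the reduced graph $\Gamma^*$ is the subgraph induced by the non-dominant vertices. *)

(* Defs.v *)
From HB Require Import structures.
From mathcomp Require Import all_boot all_fingroup all_solvable.
Set Implicit Arguments. Unset Strict Implicit. Unset Printing Implicit Defensive.
Local Open Scope group_scope.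

Definition stem_extension (gT hT : finGroupType) (G : {set gT})
  (E : {group hT}) (f : {morphism E >-> gT}) : Prop :=
  f @* E = G /\ 'ker f \subset 'Z(E) :&: E^`(1).

Definition schur_cover (gT hT : finGroupType) (G : {set gT})
  (E : {group hT}) (f : {morphism E >-> gT}) : Prop :=
  stem_extension G f /\
  forall (kT : finGroupType) (E' : {group kT}) (g : {morphism E' >-> gT}),
    stem_extension G g -> #|'ker g| <= #|'ker f|.

(* Deep commuting graph on vertex set G, w.r.t. the cover f : E -> G:
   distinct x, y in G are adjacent iff some preimages commute in E
   (since the kernel is central, this does not depend on the preimages). *)
Definition deep_adj (gT hT : finGroupType) (G : {set gT})
  (E : {group hT}) (f : {morphism E >-> gT}) (x y : gT) : bool :=
  [&& x \in G, y \in G, x != y &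
   [exists x' in E, exists y' in E,
      [&& f x' == x, f y' == y & x' * y' == y' * x']]].

Definition dominant (gT hT : finGroupType) (G : {set gT})
  (E : {group hT}) (f : {morphism E >-> gT}) (x : gT) : bool :=
  (x \in G) && [forall y in G, (y != x) ==> deep_adj G f x y].

Definition nondominant (gT hT : finGroupType) (G : {set gT})
  (E : {group hT}) (f : {morphism E >-> gT}) : {set gT} :=
  [set x in G | ~~ dominant G f x].

Definition reduced_adj (gT hT : finGroupType) (G : {set gT})
  (E : {group hT}) (f : {morphism E >-> gT}) : rel gT :=
  fun x y => [&& x \in nondominant G f, y \in nondominant G f & deep_adj G f x y].

Definition reduced_connected (gT hT : finGroupType) (G : {set gT})
  (E : {group hT}) (f : {morphism E >-> gT}) : Prop :=
  nondominant G f != set0 /\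
  forall x y, x \in nondominant G f -> y \in nondominant G f ->
    connect (reduced_adj G f) x y.

(* Main.v *)
Require Import Defs.
From HB Require Import structures.
From mathcomp Require Import all_boot all_fingroup all_solvable.

(* The argument works for every central extension of [A_n]: commutators of lifts
   of commuting elements are central, bimultiplicative and invariant under
   conjugation, so lifts of commuting [x] and [y] commute as soon as the orders of
   [x] and [y] are coprime, or some [g] fixes [y] and sends [x] to [x ^+ a] with
   [a - 1] prime to the order of [x].

   If none of [n], [n - 1], [n - 2] is prime then [n >= 10]. Disjoint 3-cycles are
   adjacent, so all 3-cycles are linked, and it is enough to link each [x] of prime
   order [p] to a 3-cycle. For [p = 2] go through a 3-cycle of fixed points, or an
   element permuting three 2-cycles of [x]; for [p = 3] take a cycle of [x]; for
   [p >= 5] take a cycle of [x], which leaves at least three points fixed.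

   If [p], one of the three numbers, is prime, then an element of order [p]
   generates its own centraliser in [A_n], whence a separate component. *)

Set Implicit Arguments. Unset Strict Implicit. Unset Printing Implicit Defensive.
Import GroupScope.

(** * Commutators of lifts in a central extension *)

Section CentralExtension.

Variables (hT gT : finGroupType) (E : {group hT}) (f : {morphism E >-> gT}).
Variable G : {group gT}.
Hypotheses (imf : f @* E = G) (kerZ : 'ker f \subset 'Z(E)).

(** The commuting clause of [deep_adj] alone; dropping distinctness makes it reflexive on [G]. *)
Definition deep (x y : gT) : bool :=
  [exists x' in E, exists y' in E,
      [&& f x' == x, f y' == y & x' * y' == y' * x']].

Lemma liftP x : x \in G -> exists2 x', x' \in E & f x' = x.
Proof. by rewrite -imf => /morphimP[x' _ Ex' ->]; exists x'. Qed.

Lemma ker_commute k y : k \in 'ker f -> y \in E -> commute k y.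
Proof. by move=> /(subsetP kerZ)/centerP[_ cEk] /cEk. Qed.

(** Two lifts of the same element differ by a central kernel element, so one lift may be fixed. The
    elements deep to [f x'] thus form a subgroup. *)
Lemma deep_morphim x' : x' \in E -> deep (f x') =1 [in f @* 'C_E[x']].
Proof.
move=> Ex y; apply/idP/idP => [|/morphimP[y' _ /setIP[Ey /cent1P cxy] ->]].
  case/existsP=> x1 /andP[Ex1 /existsP[y1 /andP[Ey1 /and3P[/eqP fx1 /eqP <- /eqP c11]]]].
  apply: mem_morphim => //; rewrite inE Ey1; apply/cent1P.
  have Kk : x1^-1 * x' \in 'ker f.
    by rewrite mem_morphpre ?groupM ?groupV // inE morphM ?groupV // morphV // fx1 mulVg.
  rewrite -(mulKVg x1 x'); apply: commuteM; first by apply/esym.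
  by apply/esym/ker_commute.
apply/existsP; exists x'; rewrite Ex; apply/existsP; exists y'.
by rewrite Ey !eqxx /= cxy.
Qed.

Lemma deep_commute x y : deep x y -> commute x y.
Proof.
case/existsP=> x' /andP[Ex /existsP[y' /andP[Ey /and3P[/eqP <- /eqP <- /eqP cxy]]]].
by rewrite /commute -!morphM // cxy.
Qed.

Lemma deep_sym x y : deep x y = deep y x.
Proof.
by apply/idP/idP=> /existsP[x' /andP[Ex /existsP[y' /andP[Ey /and3P[fx fy /eqP cxy]]]]];
  apply/existsP; exists y'; rewrite Ey; apply/existsP; exists x'; rewrite Ex fx fy cxy /=.
Qed.

Lemma deepM x y z : x \in G -> deep x y -> deep x z -> deep x (y * z).
Proof. by case/liftP=> x' Ex <-; rewrite !deep_morphim // => *; apply: groupM. Qed.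

Lemma deep1 x : x \in G -> deep x 1.
Proof. by case/liftP=> x' Ex <-; rewrite deep_morphim // group1. Qed.

Lemma deep_refl x : x \in G -> deep x x.
Proof.
case/liftP=> x' Ex <-; rewrite deep_morphim //.
by apply: mem_morphim => //; rewrite inE Ex cent1id.
Qed.

Lemma deepX x n : x \in G -> deep x (x ^+ n).
Proof.
case/liftP=> x' Ex <-; rewrite deep_morphim //.
by apply: groupX; apply: mem_morphim => //; rewrite inE Ex cent1id.
Qed.

Lemma lift_comm_ker x' y' : x' \in E -> y' \in E -> commute (f x') (f y') ->
  [~ x', y'] \in 'ker f.
Proof.
move=> Ex Ey /commgP/eqP c; rewrite mem_morphpre ?groupR // inE morphR //.
by rewrite c.
Qed.

(* The commutator of two lifts is bimultiplicative because it is central. *)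
Lemma lift_commX x' y' n : x' \in E -> y' \in E -> commute (f x') (f y') ->
  [~ x' ^+ n, y'] = [~ x', y'] ^+ n.
Proof.
move=> Ex Ey /(lift_comm_ker Ex Ey) Kc; apply: commXg.
by apply/esym/ker_commute.
Qed.

(** The relevant power of the commutator is the commutator of [x' ^+ #[f x']], which lies in the
    central kernel, with [y']. *)
Lemma lift_comm_order x' y' : x' \in E -> y' \in E -> commute (f x') (f y') ->
  #[ [~ x', y'] ] %| #[f x'].
Proof.
move=> Ex Ey c; rewrite order_dvdn -lift_commX //; apply/commgP.
apply: ker_commute => //.
by rewrite mem_morphpre ?groupX // inE morphX // expg_order.
Qed.

(** The order of the central commutator of two lifts divides both [#[x]] and [#[y]]. *)
Lemma deep_coprime x y : x \in G -> y \in G -> commute x y ->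
  coprime #[x] #[y] -> deep x y.
Proof.
case/liftP=> x' Ex <- /liftP[y' Ey <-] c co.
have oxy := lift_comm_order Ex Ey c.
have oyx := lift_comm_order Ey Ex (esym c).
rewrite -invg_comm orderV in oyx.
have /eqP : #[ [~ x', y'] ] == 1%N by rewrite -dvdn1 -(eqnP co) dvdn_gcd oxy.
move/eqP; rewrite order_eq1 => /commgP cxy.
rewrite deep_morphim //; apply: mem_morphim => //.
by rewrite inE Ey; apply/cent1P.
Qed.

(* Conjugation by [g] raises the central commutator of lifts of [x] and [y] to
   the power [a.+1], while fixing it. *)
Lemma deep_conjX x y g a : x \in G -> y \in G -> g \in G -> commute x y ->
  x ^ g = x ^+ a.+1 -> y ^ g = y -> coprime #[x] a -> deep x y.
Proof.
case/liftP=> x' Ex <- /liftP[y' Ey <-] /liftP[g' Eg <-] c xg yg co.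
have oxy := lift_comm_order Ex Ey c.
have Kc := lift_comm_ker Ex Ey c.
have kerV u v : u \in E -> v \in E -> f u = f v -> u * v^-1 \in 'ker f.
  move=> Eu Ev fuv; rewrite mem_morphpre ?groupM ?groupV //.
  by rewrite inE morphM ?groupV // morphV // fuv mulgV.
have ker_comm k u v : k \in 'ker f -> u \in E -> v \in E ->
    [~ k * u, v] = [~ u, v].
  move=> Kk Eu Ev; rewrite commMgJ; have /commgP/eqP -> := ker_commute Kk Ev.
  by rewrite conj1g mul1g.
have e1 : [~ x', y'] ^ g' = [~ x', y'].
  by apply/conjg_fixP/commgP/ker_commute.
have fxg : f (x' ^ g') = f (x' ^+ a.+1) by rewrite morphJ // xg morphX.
have fyg : f (y' ^ g') = f y' by rewrite morphJ.
have e2 : [~ x', y'] ^ g' = [~ x', y'] ^+ a.+1.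
  (* The conjugated lifts differ from [x' ^+ a.+1] and [y'] by kernel elements, which do not affect
     commutators. *)
  rewrite conjRg -(mulgKV (x' ^+ a.+1) (x' ^ g')) -(mulgKV y' (y' ^ g')).
  rewrite ker_comm ?kerV ?groupX ?groupJ ?groupM ?groupV ?groupJ //.
  rewrite -invg_comm ker_comm ?kerV ?groupX ?groupJ // invg_comm.
  exact: lift_commX.
have : [~ x', y'] ^+ a == 1.
  by rewrite -(inj_eq (mulgI [~ x', y'])) -expgS -e2 e1 mulg1.
rewrite -order_dvdn => oa.
have: #[ [~ x', y'] ] %| 1 by rewrite -(eqnP co) dvdn_gcd oxy.
rewrite dvdn1 order_eq1 => /commgP cxy.
rewrite deep_morphim //; apply: mem_morphim => //.
by rewrite inE Ey; apply/cent1P.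
Qed.
End CentralExtension.

(** * Even permutations and 3-cycles *)

Section Permutations.

Variable T : finType.
Implicit Types (x s : {perm T}) (a b c i : T) (S : {set T}).

Lemma perm_on_fix S s i : perm_on S s -> i \notin S -> s i = i.
Proof. by move=> Ss; apply: contraNeq => /(subsetP Ss). Qed.

Lemma perm_onX S s n : perm_on S s -> perm_on S (s ^+ n).
Proof.
by move=> Ss; elim: n => [|n IH]; rewrite ?expg0 ?perm_on1 // expgS perm_onM.
Qed.

Lemma perm_on_tperm S a b : a \in S -> b \in S -> perm_on S (tperm a b).
Proof.
by move=> Sa Sb; apply/subsetP=> i; rewrite !inE; case: tpermP => [->|->|]; rewrite ?eqxx.
Qed.

Lemma odd_permX x n : odd_perm (x ^+ n) = odd n && odd_perm x.
Proof.
elim: n => [|n IH]; first by rewrite expg0 odd_perm1.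
by rewrite expgS odd_permM IH /=; case: odd; case: odd_perm.
Qed.

Lemma odd_order_Alt x p : odd p -> x ^+ p = 1 -> x \in 'Alt_T.
Proof.
by move=> op xp; rewrite Alt_even; have := odd_permX x p;
  rewrite xp odd_perm1 op /= => <-.
Qed.

Lemma prime_order_eq x p : prime p -> x ^+ p = 1 -> x != 1 -> #[x] = p.
Proof.
move=> pp /eqP; rewrite -order_dvdn => xp; rewrite -order_eq1 => x1.
by case/primeP: pp => _ /(_ _ xp)/orP[|/eqP//]; rewrite (negPf x1).
Qed.

Lemma moved_point x : x != 1 -> exists i, x i != i.
Proof.
move=> x1; apply/existsP; apply: contraNT x1; rewrite negb_exists => /forallP h.
by apply/eqP/permP=> i; rewrite perm1; apply/eqP/negPn/h.
Qed.

(** For distinct points, the cycle [a] to [b] to [c] to [a], products being read from left to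
    right. *)
Definition cycle3 a b c : {perm T} := tperm a b * tperm a c.

Lemma cycle3E a b c : uniq [:: a; b; c] ->
  [/\ cycle3 a b c a = b, cycle3 a b c b = c, cycle3 a b c c = a &
   forall i, i \notin [:: a; b; c] -> cycle3 a b c i = i].
Proof.
rewrite /= !inE negb_or andbT => /andP[/andP[ab ac] bc].
rewrite /cycle3 !permM; split.
- by rewrite tpermL tpermD // eq_sym.
- by rewrite tpermR tpermL.
- by rewrite (tpermD ac bc) tpermR.
- move=> i; rewrite !inE !negb_or => /and3P[ia ib ic].
  by rewrite permM !tpermD // eq_sym.
Qed.

Lemma cycle3_rot a b c : uniq [:: a; b; c] -> cycle3 b c a = cycle3 a b c.
Proof.
move=> u; have [e1 e2 e3 e4] := cycle3E u.
have u' : uniq [:: b; c; a] by rewrite (rot_uniq 1 [:: a; b; c]).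
have [d1 d2 d3 d4] := cycle3E u'.
apply/permP=> i; have [] := boolP (i \in [:: a; b; c]).
  by rewrite !inE => /or3P[]/eqP->; congruence.
by move=> ni; rewrite e4 // d4 // (mem_rot 1 [:: a; b; c]).
Qed.

Lemma cycle3_on S a b c : {subset [:: a; b; c] <= S} -> perm_on S (cycle3 a b c).
Proof.
move=> h; apply: perm_onM; apply: perm_on_tperm; apply: h; rewrite !inE eqxx ?orbT //.
Qed.

Lemma cycle3_Alt a b c : uniq [:: a; b; c] -> cycle3 a b c \in 'Alt_T.
Proof.
rewrite Alt_even odd_permM !odd_tperm /= !inE negb_or andbT.
by case/andP=> /andP[-> ->] _.
Qed.

Lemma cycle3_neq1 a b c : uniq [:: a; b; c] -> cycle3 a b c != 1.
Proof.
move=> u; have [e1 _ _ _] := cycle3E u; apply/eqP=> /permP/(_ a).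
by rewrite e1 perm1 => e; move: u; rewrite e /= inE eqxx.
Qed.

Lemma cycle3_exp3 a b c : uniq [:: a; b; c] -> cycle3 a b c ^+ 3 = 1.
Proof.
move=> u; have [e1 e2 e3 e4] := cycle3E u.
rewrite !expgS expg0 mulg1; apply/permP=> i; rewrite 2!permM perm1.
have [] := boolP (i \in [:: a; b; c]); last by move=> ni; rewrite !e4.
by rewrite !inE => /or3P[]/eqP->; congruence.
Qed.

Lemma cycle3J a b c s : cycle3 a b c ^ s = cycle3 (s a) (s b) (s c).
Proof. by rewrite conjMg !tpermJ. Qed.

(** The transposition reverses the cycle, and the inverse of an element of order 3 is its square. *)
Lemma cycle3_tperm a b c : uniq [:: a; b; c] ->
  cycle3 a b c ^ tperm a b = cycle3 a b c ^+ 2.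
Proof.
move=> u; have [e1 e2 e3 e4] := cycle3E u.
have u' : uniq [:: b; a; c].
  by move: u; rewrite /= !inE !negb_or (eq_sym b a) !andbT => /andP[/andP[-> ->] ->].
have [d1 d2 d3 d4] := cycle3E u'.
have sc : tperm a b c = c.
  by move: u; rewrite /= !inE negb_or andbT => /andP[/andP[_ ac] bc]; rewrite tpermD.
rewrite cycle3J tpermL tpermR sc; apply/permP=> i; rewrite expgS expg1 [RHS]permM.
have [] := boolP (i \in [:: a; b; c]).
  by rewrite !inE => /or3P[]/eqP->; congruence.
by move=> ni; rewrite d4 ?e4 //; move: ni; rewrite !inE orbCA.
Qed.

Lemma card_gt2_pick S : 2 < #|S| ->
  exists a b c, uniq [:: a; b; c] /\ {subset [:: a; b; c] <= S}.
Proof.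
rewrite cardE => h.
case e: (enum S) h => [|a [|b [|c l]]] // _; exists a, b, c; split.
  have: uniq (enum S) by apply: enum_uniq.
  by rewrite e /= !inE !negb_or => /and4P[/and3P[-> -> _] /andP[-> _]].
by move=> i h; rewrite -mem_enum e -[[:: a, b, c & l]]/([:: a; b; c] ++ l) mem_cat h.
Qed.

(** If [x] moves [i], a 3-cycle on [x i] and two points other than [i] and [x i] fixes [i] but moves
    [x i]. *)
Lemma Alt_center_trivial x : 3 < #|T| -> x != 1 ->
  exists2 y, y \in 'Alt_T & ~ commute x y.
Proof.
move=> T4 /moved_point[i xi].
have: 1 < #|~: [set i; x i]|.
  by rewrite -(ltn_add2l #|[set i; x i]|) cardsC cards2 eq_sym xi.
case/card_gt1P=> k [l [+ + kl]]; rewrite !inE !negb_or => /andP[ki kx] /andP[li lx].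
have u : uniq [:: x i; k; l] by rewrite /= !inE negb_or eq_sym kx eq_sym lx kl.
have [e1 _ _ e4] := cycle3E u.
exists (cycle3 (x i) k l); first exact: cycle3_Alt.
move=> /permP/(_ i); rewrite permM [RHS]permM e1 e4; last first.
  by rewrite !inE !negb_or eq_sym xi eq_sym ki eq_sym li.
by move=> e; rewrite e eqxx in kx.
Qed.

(** The orbit length divides the order [p], and length 1 would make [i] a fixed point. *)
Lemma card_porbit_prime x p i : prime p -> x ^+ p = 1 -> x i != i ->
  #|porbit x i| = p.
Proof.
move=> pp xp xi; have x1 : x != 1 by apply: contraNneq xi => ->; rewrite perm1.
have := dvdn_orbit 'P <[x]> i; rewrite -porbitE -orderE (prime_order_eq pp xp x1).
case/primeP: pp => _ h /h/orP[|/eqP//].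
move=> /cards1P[j e]; case/negP: xi.
have := mem_porbit x 1 i; have := porbit_id x i.
by rewrite e !inE expg1 => /eqP-> /eqP->.
Qed.

End Permutations.

(** * Splitting one cycle off a permutation with cube 1 *)

Section CycleRemoval.

Variables (T : finType) (z : {perm T}) (i : T).
Hypotheses (z3 : z ^+ 3 = 1) (zi : z i != i).

Let s := cycle3 i (z i) (z (z i)).

Lemma exp3_iter j : z (z (z j)) = j.
Proof. by have /permP/(_ j) := z3; rewrite !expgS expg0 mulg1 !permM perm1. Qed.

Lemma exp3_uniq : uniq [:: i; z i; z (z i)].
Proof.
rewrite /= !inE negb_or (inj_eq perm_inj) (eq_sym i (z i)) zi !andbT.
by apply: contra zi => /eqP e; rewrite -{2}(exp3_iter i) -e.
Qed.

(** Conjugation by [z] only rotates the entries of [s], so [s] and [z] commute and the quotient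
    still has cube 1. *)
Lemma cycle3_removal :
  [/\ (s^-1 * z) ^+ 3 = 1, forall j, z j = j -> (s^-1 * z) j = j &
      {in [:: i; z i; z (z i)], forall j, (s^-1 * z) j = j}].
Proof.
have u := exp3_uniq; have [e1 e2 e3 e4] := cycle3E u.
have sz : commute s z.
  by apply/commgP/conjg_fixP; rewrite cycle3J exp3_iter cycle3_rot.
have szE j k : s k = j -> (s^-1 * z) j = z k by move=> <-; rewrite permM permK.
split.
- rewrite expgMn; last by apply/commute_sym/commuteV/commute_sym.
  by rewrite expgVn cycle3_exp3 // z3 invg1 mulg1.
- move=> j zj; rewrite (szE j j) // e4 // !inE; apply/negP=> h.
  case/negP: zi; apply/eqP; move: zj.
  by case/or3P: h => /eqP->; do ?move/perm_inj.
- move=> j; rewrite !inE => /or3P[]/eqP->.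
  + by rewrite (szE _ _ e3) exp3_iter.
  + by rewrite (szE _ _ e1).
  + by rewrite (szE _ _ e2).
Qed.

End CycleRemoval.

(** * Deep commutation of elements of order 3 *)

Section AltExtension.

Variables (T : finType) (hT : finGroupType) (E : {group hT}).
Variable f : {morphism E >-> {perm T}}.
Hypotheses (imf : f @* E = 'Alt_T) (kerZ : 'ker f \subset 'Z(E)).
Hypothesis T8 : 7 < #|T|.

(* Two further points provide an even permutation inverting the first cycle and
   centralising the second. *)
Lemma deep_cycle3_disjoint a b c d e g :
  uniq [:: a; b; c] -> uniq [:: d; e; g] ->
  {in [:: a; b; c], forall j, j \notin [:: d; e; g]} ->
  deep f (cycle3 a b c) (cycle3 d e g).
Proof.
move=> u u' dis.
pose A := [set j in [:: a; b; c]]; pose D := [set j in [:: d; e; g]].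
have cA : #|A| = 3 by rewrite cardsE; apply/card_uniqP.
have cD : #|D| = 3 by rewrite cardsE; apply/card_uniqP.
have dAD : [disjoint A & D].
  apply/pred0P=> j /=; rewrite ![_ \in [set _ | _]]inE.
  by apply/negbTE/negP=> /andP[/dis/negP].
have onA : perm_on A (cycle3 a b c) by apply: cycle3_on => j; rewrite [_ \in A]inE.
have onD : perm_on D (cycle3 d e g) by apply: cycle3_on => j; rewrite [_ \in D]inE.
(* The two 3-cycles take at most six of at least eight points. *)
have : 1 < #|~: (A :|: D)|.
  rewrite -(ltn_add2l #|A :|: D|) cardsC (leq_trans _ T8) // ltnS.
  by rewrite addn1 ltnS (leq_trans (leq_card_setU _ _)) // cA cD.
case/card_gt1P=> k [l [+ + kl]].
rewrite !in_setC !in_setU !negb_or => /andP[kA kD] /andP[lA lD].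
have onkl (S : {set T}) : k \notin S -> l \notin S -> [disjoint [set k; l] & S].
  move=> kS lS; apply/pred0P=> j /=; rewrite !inE; apply/negbTE/negP.
  by case/andP=> /orP[]/eqP->; apply/negP.
have tkl : perm_on [set k; l] (tperm k l).
  by apply: perm_on_tperm; rewrite !inE eqxx ?orbT.
have tab : perm_on A (tperm a b) by apply: perm_on_tperm; rewrite !inE eqxx ?orbT.
have ab : a != b by move: u; rewrite /= !inE negb_or => /andP[/andP[]].
(* Inverting a 3-cycle squares it, so [a.+1] is 2. *)
apply: (deep_conjX (g := tperm a b * tperm k l) (a := 1) imf kerZ).
- exact: cycle3_Alt.
- exact: cycle3_Alt.
- by rewrite Alt_even odd_permM !odd_tperm ab kl.
- exact: perm_onC onA onD dAD.
- rewrite conjgM cycle3_tperm //; apply/conjg_fixP/commgP.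
  by apply/commute_sym/(perm_onC tkl (perm_onX 2 onA))/onkl.
- apply/conjg_fixP/commgP/commuteM; last first.
    by apply/commute_sym/(perm_onC tkl onD)/onkl.
  by apply/commute_sym/(perm_onC tab onD).
- by rewrite coprimen1.
Qed.

(** Induction on the number of points moved by [z]: split off one 3-cycle of [z] and recombine with
    [deepM]. *)
Lemma deep_cycle3_exp3_disjoint a b c (z : {perm T}) :
  uniq [:: a; b; c] -> z ^+ 3 = 1 -> {in [:: a; b; c], forall j, z j = j} ->
  deep f (cycle3 a b c) z.
Proof.
move=> u; have tA := cycle3_Alt u.
have [m] := ubnP #|[set j | z j != j]|; elim: m z => // m IH z ltm z3 zfix.
have [->|/moved_point[i zi]] := eqVneq z 1; first exact: (deep1 imf kerZ tA).
have [w3 wfix wi] := cycle3_removal z3 zi.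
have u' := exp3_uniq z3 zi.
rewrite -(mulKVg (cycle3 i (z i) (z (z i))) z).
apply: (deepM imf kerZ) => //.
  apply: deep_cycle3_disjoint => // j /zfix zj; rewrite !inE; apply/negP.
  by case/or3P=> /eqP e; case/negP: zi; move: zj; rewrite e; do ?move/perm_inj; move/eqP.
apply: IH => //; last by move=> j /zfix/wfix.
rewrite ltnS in ltm; apply: leq_trans ltm; apply: proper_card; apply/properP; split.
  by apply/subsetP=> j; rewrite !inE; apply: contra => /eqP/wfix/eqP.
by exists i; rewrite !inE // wi ?eqxx // inE eqxx.
Qed.

(** The cycle is deep to itself and to the rest of [z], which is disjoint from it, hence to their
    product. *)
Lemma deep_exp3_cycle3 (z : {perm T}) i : z ^+ 3 = 1 -> z i != i ->
  deep f (cycle3 i (z i) (z (z i))) z.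
Proof.
move=> z3 zi; have [w3 _ wi] := cycle3_removal z3 zi.
have u := exp3_uniq z3 zi; have sA := cycle3_Alt u.
have ss := deep_refl imf kerZ sA.
have sw := deep_cycle3_exp3_disjoint u w3 wi.
by have := deepM imf kerZ sA ss sw; rewrite mulKVg.
Qed.

End AltExtension.

(** * Doubling exponents along one cycle of a permutation *)

Section OrbitDoubling.

Variables (T : finType) (x : {perm T}) (i : T).
Local Notation O := (porbit x i).

Lemma porbit_stable j : (x j \in O) = (j \in O).
Proof. by rewrite porbit_sym -{2}[x]expg1 porbit_perm porbit_sym. Qed.

(** Makes multiplication of exponents well defined on the cycle of [i], where exponents count only
    modulo its length. *)
Lemma orbit_expM a b m : (x ^+ a) i = (x ^+ b) i ->
  (x ^+ (a * m)) i = (x ^+ (b * m)) i.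
Proof.
move=> e; elim: m => [|m IH]; first by rewrite !muln0.
rewrite !mulnS addnC expgD permM IH -permM -expgD addnC expgD permM e.
by rewrite -permM -expgD addnC.
Qed.

(** Doubling exponents is bijective because [p] is odd; conjugation by [h] will square the cycle of
    [x] through [i]. *)
Lemma doubling_perm p : odd p -> x ^+ p = 1 ->
  exists h : {perm T}, perm_on O h /\
    forall k, h ((x ^+ k) i) = (x ^+ (k * 2)) i.
Proof.
move=> op xp.
(* [findex] recovers an exponent [k] with [j = (x ^+ k) i], so applying [x ^+ k] to [j] doubles
   it. *)
pose h0 j := if j \in O then (x ^+ findex x i j) j else j.
have h0E k : h0 ((x ^+ k) i) = (x ^+ (k * 2)) i.
  rewrite /h0 mem_porbit; set l := findex _ _ _.
  have e : (x ^+ l) i = (x ^+ k) i.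
    by rewrite [LHS]permX iter_findex // permX fconnect_iter.
  by rewrite -e -permM -expgD addnn -muln2; apply: orbit_expM.
have h0O j : (h0 j \in O) = (j \in O).
  have [Oj|/negbTE Oj] := boolP (j \in O); last by rewrite /h0 Oj.
  by case/porbitP: Oj => k ->; rewrite h0E mem_porbit.
have h0inj : injective h0.
  move=> j j' e; have := h0O j; rewrite e h0O.
  have [|Oj' Oj] := boolP (j' \in O); last first.
    by move: e; rewrite /h0 -Oj (negbTE Oj').
  move=> /porbitP[k' ek'] /esym/porbitP[k ek]; subst j j'.
  (* Multiplication by [(p + 1) / 2] undoes doubling modulo [p]. *)
  rewrite !h0E in e; have := orbit_expM p.+1./2 e.
  have hp m : x ^+ (m * 2 * p.+1./2) = x ^+ m.
    rewrite -mulnA mul2n -[p.+1./2.*2]add0n.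
    have -> : (0 + p.+1./2.*2)%N = p.+1.
      by rewrite add0n -[RHS]odd_double_half /= op.
    by rewrite mulnS expgD mulnC expgM xp expg1n mulg1.
  by rewrite !hp.
exists (perm h0inj); split; last by move=> k; rewrite permE h0E.
by apply/subsetP=> j; rewrite inE permE /h0; case: ifP; rewrite ?eqxx.
Qed.

Lemma restr_porbitE j : j \in O -> restr_perm O x j = x j.
Proof. by apply: restr_permE; apply/astabsP=> k; rewrite /= apermE porbit_stable. Qed.

Lemma restr_porbitX k j : j \in O -> (restr_perm O x ^+ k) j = (x ^+ k) j.
Proof.
move=> Oj; elim: k => [|k IH]; first by rewrite !expg0.
rewrite !expgSr !permM IH restr_porbitE //.
by case/porbitP: Oj => m ->; rewrite -permM -expgD mem_porbit.
Qed.

Lemma restr_porbit_exp p : x ^+ p = 1 -> restr_perm O x ^+ p = 1.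
Proof.
move=> xp; apply/permP=> j; have [Oj|Oj] := boolP (j \in O).
  by rewrite restr_porbitX // xp.
by rewrite perm1 (perm_on_fix (perm_onX p (restr_perm_on O x)) Oj).
Qed.

(** Splits [x] into its cycle on [O] and a factor with disjoint support. *)
Lemma restr_porbit_quotient : perm_on (~: O) ((restr_perm O x)^-1 * x).
Proof.
have on1 := restr_perm_on O x.
apply/subsetP=> j; rewrite !inE; apply: contra => Oj; apply/eqP.
rewrite permM -restr_porbitE ?permKV //.
by rewrite (perm_closed _ (perm_onV on1)).
Qed.

End OrbitDoubling.

(** * Linking vertices of the reduced graph to 3-cycles *)

Section DeepCommutingGraph.

Variables (T : finType) (hT : finGroupType) (E : {group hT}).
Variable f : {morphism E >-> {perm T}}.
Hypotheses (imf : f @* E = 'Alt_T) (kerZ : 'ker f \subset 'Z(E)).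

(* Conjugation by the square of the doubling permutation is even and raises the
   cycle to its fourth power, and [4 - 1] is coprime to [p]. *)
Lemma deep_restr_porbit p (x : {perm T}) i : prime p -> 3 < p -> x ^+ p = 1 ->
  deep f (restr_perm (porbit x i) x) x.
Proof.
move=> pp p3 xp; have op : odd p by case: (even_prime pp) p3 => [->|].
set O := porbit x i; set x1 := restr_perm O x; set w := x1^-1 * x.
have x1p : x1 ^+ p = 1 by apply: restr_porbit_exp.
have x1A : x1 \in 'Alt_T by apply: odd_order_Alt op x1p.
have xA : x \in 'Alt_T by apply: odd_order_Alt op xp.
have wA : w \in 'Alt_T by rewrite groupM ?groupV.
have x1O : perm_on O x1 := restr_perm_on O x.
have wO : perm_on (~: O) w := restr_porbit_quotient x i.
have dO : [disjoint O & ~: O] by rewrite -setI_eq0 setICr.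
have [h [hO hE]] := doubling_perm i op xp.
have x1h : x1 ^ h = x1 ^+ 2.
  (* Both [x1 * h] and [h * x1 ^+ 2] take exponent [k] to [2 * k + 2] on [O], and both are trivial
     off [O]. *)
  rewrite conjgE; apply: (mulgI h); rewrite mulKVg; apply/permP=> j.
  rewrite permM [RHS]permM; have [/porbitP[k ->]|Oj] := boolP (j \in O).
    rewrite hE restr_porbitE ?mem_porbit // restr_porbitX ?mem_porbit //.
    have -> : x ((x ^+ k) i) = (x ^+ k.+1) i by rewrite expgSr permM.
    by rewrite hE -permM -expgD mulSn addnC.
  by rewrite !(perm_on_fix _ Oj) // ?perm_onX // (perm_on_fix hO Oj).
have wh : w ^ h = w by apply/conjg_fixP/commgP/commute_sym/(perm_onC hO wO dO).
have xw : deep f x1 w.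
  apply: (deep_conjX (g := h ^+ 2) (a := 3) imf kerZ) => //.
  - by rewrite Alt_even odd_permX.
  - exact: perm_onC x1O wO dO.
  - by rewrite expgS expg1 conjgM x1h conjXg x1h -expgM.
  - by rewrite expgS expg1 conjgM !wh.
  - apply: (@coprime_dvdl _ p); first by rewrite order_dvdn x1p.
    by rewrite prime_coprime // (gtnNdvd _ p3).
have := deepM imf kerZ x1A (deep_refl imf kerZ x1A) xw.
by rewrite mulKVg.
Qed.

(** The identity is deep to everything, while a dominant element is central, and the centre is
    trivial. *)
Lemma nondominantE x : 3 < #|T| ->
  (x \in nondominant 'Alt_T f) = (x \in 'Alt_T) && (x != 1).
Proof.
move=> T4; rewrite inE; have [xA|//] := boolP (x \in 'Alt_T).
rewrite /dominant xA /=; congr (~~ _).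
apply/idP/idP => [/forall_inP h|/eqP->]; last first.
  apply/forall_inP=> y yA; apply/implyP=> y1.
  rewrite /deep_adj group1 yA eq_sym y1 -/(deep f 1 y) deep_sym.
  exact: (deep1 imf kerZ yA).
apply/negPn/negP=> x1; have [y yA ncxy] := Alt_center_trivial T4 x1.
apply: ncxy; have [->//|yx] := eqVneq y x.
by have /and4P[_ _ _ /(deep_commute (f := f))] := implyP (h y yA) yx.
Qed.

Local Notation link := (connect (reduced_adj 'Alt_T f)).

Lemma link_sym : symmetric link.
Proof.
apply: sym_connect_sym => x y.
rewrite /reduced_adj andbCA; do 2!congr andb.
by rewrite /deep_adj andbCA eq_sym -/(deep f x y) deep_sym.
Qed.

Lemma deep_link x y : 3 < #|T| -> x \in 'Alt_T -> x != 1 -> y \in 'Alt_T ->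
  y != 1 -> deep f x y -> link x y.
Proof.
move=> T4 xA x1 yA y1 dxy; have [->|nxy] := eqVneq x y; first exact: connect0.
by apply: connect1; rewrite /reduced_adj !nondominantE // xA x1 yA y1 /deep_adj xA yA nxy.
Qed.

Hypothesis T10 : 9 < #|T|.
Let T8 : 7 < #|T| := ltn_trans (ltn_trans (ltnSn 7) (ltnSn 8)) T10.
Let T4 : 3 < #|T| := leq_trans (isT : 3 < 8) T8.

(** Two 3-cycles cover at most six of at least ten points, leaving room for a 3-cycle disjoint from
    both. *)
Lemma cycle3_link a b c d e g : uniq [:: a; b; c] -> uniq [:: d; e; g] ->
  link (cycle3 a b c) (cycle3 d e g).
Proof.
move=> u u'.
have : 2 < #|~: [set j in [:: a; b; c] ++ [:: d; e; g]]|.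
  rewrite -(ltn_add2l #|[set j in [:: a; b; c] ++ [:: d; e; g]]|) cardsC.
  apply: leq_trans T10; rewrite addn2 !ltnS cardsE.
  by apply: (leq_trans (card_size _)).
case/card_gt2_pick=> k [l [m [v kS]]].
have h : {in [:: k; l; m], forall j, j \notin [:: a; b; c] ++ [:: d; e; g]}.
  by move=> j /kS; rewrite !inE.
apply: (@connect_trans _ _ (cycle3 k l m)).
  rewrite link_sym; apply: deep_link => //; rewrite ?cycle3_Alt ?cycle3_neq1 //.
  apply: deep_cycle3_disjoint => // j /h; rewrite mem_cat negb_or.
  by case/andP.
apply: deep_link => //; rewrite ?cycle3_Alt ?cycle3_neq1 //.
apply: deep_cycle3_disjoint => // j /h; rewrite mem_cat negb_or.
by case/andP.
Qed.

(** A 3-cycle on points outside [S] commutes with [x] and has order coprime to [p]. *)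
Lemma link_cycle3_outside p S (x : {perm T}) : prime p -> p != 3 -> x ^+ p = 1 ->
  x != 1 -> x \in 'Alt_T -> perm_on S x -> 2 < #|~: S| ->
  exists a b c, uniq [:: a; b; c] /\ link x (cycle3 a b c).
Proof.
move=> pp p3 xp x1 xA xS /card_gt2_pick[a [b [c [u abcS]]]].
exists a, b, c; split=> //; apply: deep_link => //; rewrite ?cycle3_Alt ?cycle3_neq1 //.
apply: (deep_coprime imf kerZ) => //; first exact: cycle3_Alt.
  by apply: (perm_onC xS (cycle3_on abcS)); rewrite -setI_eq0 setICr.
rewrite (prime_order_eq pp xp x1) (prime_order_eq _ (cycle3_exp3 u)) ?cycle3_neq1 //.
by rewrite prime_coprime // dvdn_prime2.
Qed.

(* With at most two fixed points there are three 2-cycles of [x], and [y] permutes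
   them cyclically. *)
Lemma link_involution (x : {perm T}) : x ^+ 2 = 1 -> x != 1 -> x \in 'Alt_T ->
  exists a b c, uniq [:: a; b; c] /\ link x (cycle3 a b c).
Proof.
move=> x2 x1 xA; pose S := [set j | x j != j].
have xS : perm_on S x by apply/subsetP=> j; rewrite !inE.
have [F2|F2] := ltnP 2 #|~: S|.
  exact: (link_cycle3_outside (p := 2) _ _ x2 x1 xA xS).
have xx j : x (x j) = j by rewrite -permM -[x * x]/(x ^+ 2) x2 perm1.
(* At most two fixed points and four points already listed cannot exhaust [T]. *)
have pick (s : seq T) : size s <= 4 -> exists j, x j != j /\ j \notin s.
  move=> s4; have : 0 < #|~: (~: S :|: [set j in s])|.
    rewrite -(ltn_add2l #|~: S :|: [set j in s]|) cardsC addn0.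
    apply: leq_ltn_trans (leq_card_setU _ _) _; apply: leq_ltn_trans (T8).
    apply: (@leq_trans (2 + 4)) => //; apply: leq_add => //.
    by apply: leq_trans s4; rewrite cardsE; apply: card_size.
  by case/card_gt0P=> j; rewrite !inE negb_or negbK => /andP[? ?]; exists j.
have [a [xa _]] := pick [::] isT.
have [b [xb nb]] := pick [:: a; x a] isT.
have [c [xc nc]] := pick [:: a; x a; b; x b] isT.
have u : uniq [:: a; b; c].
  move: nb nc; rewrite /= !inE !negb_or (eq_sym a b) (eq_sym a c) (eq_sym b c).
  by move=> /andP[-> _] /and4P[-> _ ->].
have tA := cycle3_Alt u; pose t := cycle3 a b c.
have ux : uniq [:: x a; x b; x c].
  by rewrite (map_inj_uniq (@perm_inj _ x) [:: a; b; c]).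
have xsw j k : (j == x k) = (x j == k) by rewrite -(inj_eq (@perm_inj _ x)) xx.
have dis : {in [:: a; b; c], forall j, j \notin [:: x a; x b; x c]}.
  move=> j; rewrite !inE !negb_or => /or3P[]/eqP->; move: nb nc; rewrite !inE !negb_or.
  - move=> /andP[_ nb] /and4P[_ nc _ _].
    by rewrite (eq_sym a (x a)) xa (xsw a b) (xsw a c) !(eq_sym (x a)) nb nc.
  - move=> /andP[_ nb] /and4P[_ _ _ nc].
    by rewrite nb (eq_sym b (x b)) xb (xsw b c) (eq_sym (x b)) nc.
  - by move=> _ /and4P[_ -> _ ->]; rewrite eq_sym xc.
have dtt : deep f t (t ^ x) by rewrite cycle3J; apply: deep_cycle3_disjoint.
have ctt := deep_commute dtt.
have [e1 e2 e3 e4] := cycle3E ux.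
(* Conjugation by [x] exchanges the commuting factors [t] and [t ^ x], so [x] centralises [y], whose
   order 3 is coprime to 2. *)
pose y := t * t ^ x.
have yA : y \in 'Alt_T by rewrite groupM // groupJ.
have y1 : y != 1.
  apply/eqP=> /permP/(_ a); rewrite permM perm1 cycle3J.
  have [-> _ _ _] := cycle3E u; rewrite e4; last by apply: dis; rewrite !inE eqxx orbT.
  by move=> ba; move: u; rewrite ba /= !inE eqxx.
have t3 : t ^+ 3 = 1 := cycle3_exp3 u.
have y3 : y ^+ 3 = 1 by rewrite expgMn // -conjXg t3 conj1g mulg1.
exists a, b, c; split=> //; apply: (@connect_trans _ _ y).
  apply: deep_link => //; apply: (deep_coprime imf kerZ) => //.
    apply/commute_sym/commgP/conjg_fixP; rewrite conjMg -conjgM.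
    by rewrite -[x * x]/(x ^+ 2) x2 conjg1 -ctt.
  by rewrite (prime_order_eq _ x2 x1) // (prime_order_eq _ y3 y1).
rewrite link_sym; apply: deep_link => //; first exact: cycle3_neq1.
exact: (deepM imf kerZ tA (deep_refl imf kerZ tA) dtt).
Qed.

Hypothesis primeT : [/\ ~~ prime #|T|, ~~ prime (#|T| - 1) & ~~ prime (#|T| - 2)].

Lemma link_prime_order p (x : {perm T}) : prime p -> x ^+ p = 1 -> x != 1 ->
  x \in 'Alt_T -> exists a b c, uniq [:: a; b; c] /\ link x (cycle3 a b c).
Proof.
move=> pp xp x1 xA.
have [p2|p2] := eqVneq p 2; first by apply: link_involution => //; rewrite -p2.
have [i xi] := moved_point x1.
have [p3|p3] := eqVneq p 3.
  subst p; have u := exp3_uniq xp xi; exists i, (x i), (x (x i)); split=> //.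
  rewrite link_sym; apply: deep_link; rewrite ?cycle3_Alt ?cycle3_neq1 //.
  exact: deep_exp3_cycle3.
have p4 : 3 < p by case: p pp p2 p3 {xp} => [|[|[|[|]]]].
pose O := porbit x i; pose y := restr_perm O x.
have cO : #|O| = p by apply: card_porbit_prime.
have yp : y ^+ p = 1 by apply: restr_porbit_exp.
have y1 : y != 1.
  apply: contraNneq xi => y1; rewrite -(restr_porbitE (porbit_id x i)).
  by rewrite -/O -/y y1 perm1.
have op : odd p by case: (even_prime pp) p2 => [->|].
have yA : y \in 'Alt_T := odd_order_Alt op yp.
(* With at most two points outside the orbit, [p] would be [#|T|], [#|T| - 1] or [#|T| - 2]. *)
have O3 : 2 < #|~: O|.
  rewrite ltnNge; apply/negP=> O2; have := cardsC O; rewrite cO.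
  case: primeT => n0 n1 n2; case: #|~: O| O2 => [|[|[|]]] // _ e;
  move: n0 n1 n2; rewrite -e ?addn0 ?addnK pp //.
have [a [b [c [u yt]]]] := link_cycle3_outside pp p3 yp y1 yA (restr_perm_on O x) O3.
exists a, b, c; split=> //; apply: connect_trans yt.
by rewrite link_sym; apply: deep_link => //; apply: deep_restr_porbit p4 xp.
Qed.

(** An element is deep to its powers, one of which has prime order. *)
Lemma link_cycle3 (x : {perm T}) : x \in 'Alt_T -> x != 1 ->
  exists a b c, uniq [:: a; b; c] /\ link x (cycle3 a b c).
Proof.
move=> xA x1; have ox : 1 < #[x] by rewrite ltn_neqAle eq_sym order_eq1 x1 order_gt0.
have pp := pdiv_prime ox; have pd := pdiv_dvd #[x].
pose y := x ^+ (#[x] %/ pdiv #[x]).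
have yp : y ^+ pdiv #[x] = 1 by rewrite -expgM divnK // expg_order.
have y1 : y != 1.
  rewrite -order_dvdn gtnNdvd ?divn_gt0 ?pdiv_gt0 // ?ltn_Pdiv ?prime_gt1 //.
  by rewrite dvdn_leq.
have yA : y \in 'Alt_T by apply: groupX.
have [a [b [c [u yt]]]] := link_prime_order pp yp y1 yA.
exists a, b, c; split=> //; apply: connect_trans yt; apply: deep_link => //.
exact: (deepX imf kerZ).
Qed.

Lemma nonprime_connected : reduced_connected 'Alt_T f.
Proof.
split.
  have [a [b [c [u _]]]] : exists a b c, uniq [:: a; b; c] /\
      {subset [:: a; b; c] <= [set: T]}.
    by apply: card_gt2_pick; rewrite cardsT (leq_trans _ T10).
  by apply/set0Pn; exists (cycle3 a b c); rewrite nondominantE // cycle3_Alt ?cycle3_neq1.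
move=> x y; rewrite !nondominantE // => /andP[xA x1] /andP[yA y1].
have [a [b [c [u xt]]]] := link_cycle3 xA x1.
have [d [e [g [v yt]]]] := link_cycle3 yA y1.
apply: connect_trans xt _; apply: connect_trans (cycle3_link u v) _.
by rewrite link_sym.
Qed.

End DeepCommutingGraph.

(** * Isolation of a cycle of large prime length *)

Section PrimeCase.

Variables (T : finType) (p : nat).
Hypotheses (pp : prime p) (p2 : 2 < p) (Tp : #|T| <= p + 2).

(** On the [p]-cycle of [x], [y] acts as some [x ^+ k]; the quotient [z] is even and moves at most
    two points, so it is trivial. *)
Lemma prime_cycle_centralizer (x y : {perm T}) : x ^+ p = 1 -> x != 1 ->
  y \in 'Alt_T -> commute x y -> y \in <[x]>.
Proof.
move=> xp x1 yA cxy; have [i xi] := moved_point x1.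
have op : odd p by case: (even_prime pp) p2 => [->|].
have xA := odd_order_Alt op xp.
have cX k j : y ((x ^+ k) j) = (x ^+ k) (y j).
  by rewrite -!permM (commuteX k (commute_sym cxy)).
set O := porbit x i.
have cO : #|O| = p by apply: card_porbit_prime.
have cF : #|~: O| <= 2 by rewrite -(leq_add2l #|O|) cardsC cO.
(* Otherwise [y i] would lie in a second orbit of length [p] among at most two points. *)
have Oyi : y i \in O.
  apply/negPn/negP=> nO; have : #|porbit x (y i)| <= #|~: O|.
    apply/subset_leq_card/subsetP=> j /porbitP[k ->].
    rewrite inE porbit_sym porbit_perm porbit_sym //.
  rewrite (card_porbit_prime pp xp); last first.
    by have := cX 1%N i; rewrite expg1 => <-; rewrite (inj_eq perm_inj).
  by move=> h; have := leq_trans p2 (leq_trans h cF).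
have [k yi] := porbitP _ _ _ Oyi.
pose z := y * (x ^+ k)^-1.
suff z1 : z = 1 by rewrite -(mulgKV (x ^+ k) y) -/z z1 mul1g mem_cycle.
have zA : z \in 'Alt_T by rewrite groupM ?groupV ?groupX.
have zO : perm_on (~: O) z.
  apply/subsetP=> j; rewrite !inE; apply: contra => /porbitP[m ->].
  by rewrite permM cX yi -[(x ^+ m) _]permM -expgD addnC expgD permM permK.
apply/eqP/negPn/negP=> /moved_point[j zj].
have jF : j \in ~: O by apply: (subsetP zO).
have zjF : z j \in ~: O by rewrite (perm_closed _ zO).
have FE : ~: O = [set j; z j].
  apply/esym/eqP; rewrite eqEcard subUset !sub1set jF zjF cards2 eq_sym zj /=.
  exact: cF.
(* A nontrivial [z] can only swap the two points outside [O], and a transposition is odd. *)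
have zE : z = tperm j (z j).
  apply/permP=> l; case: tpermP => [-> //|->|lj lz].
    have: z (z j) \in ~: O by rewrite (perm_closed _ zO).
    by rewrite FE !inE (inj_eq perm_inj) (negbTE zj) orbF => /eqP.
  by apply: (perm_on_fix zO); rewrite FE !inE negb_or; apply/andP; split; apply/eqP.
by move: zA; rewrite zE Alt_even odd_tperm eq_sym zj.
Qed.

(** Every nontrivial element of [<[x]>] has all its neighbours in [<[x]>], so a path from [x] never
    reaches an element not commuting with [x]. *)
Lemma prime_disconnected (hT : finGroupType) (E : {group hT})
    (f : {morphism E >-> {perm T}}) :
  f @* E = 'Alt_T -> 'ker f \subset 'Z(E) -> 3 < #|T| -> p <= #|T| ->
  ~ reduced_connected 'Alt_T f.
Proof.
move=> imf kerZ T4 pT [_ conn].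
have /(Cauchy pp)[x xA ox] : p %| #|'Alt_T|.
  (* The odd prime [p] divides the factorial of [#|T|], which is twice the order of the alternating
     group. *)
  have cA := card_Alt (leq_trans (isT : 1 < 4) T4).
  rewrite -(@Gauss_dvdr p 2) ?cA ?dvdn_fact ?prime_gt0 //.
  by rewrite prime_coprime // gtnNdvd.
have x1 : x != 1 by rewrite -order_eq1 ox neq_ltn prime_gt1 ?orbT.
have [y yA ncxy] := Alt_center_trivial T4 x1.
have y1 : y != 1 by apply/eqP=> y1; apply: ncxy; rewrite y1; apply: commute1.
have yx : y \notin <[x]>.
  by apply/negP=> /cycleP[k e]; apply: ncxy; rewrite e; apply: commuteX.
have := conn x y; rewrite !(nondominantE imf kerZ) // xA x1 yA y1.
move=> /(_ isT isT)/connectP[s].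
suff h : forall u, u \in <[x]> -> u != 1 -> path (reduced_adj 'Alt_T f) u s ->
    last u s \in <[x]>.
  by move=> /(h x (cycle_id x) x1) + e; rewrite -e (negbTE yx).
elim: s => //= v s IH u ux u1 /andP[/and3P[_ vN /and4P[_ _ _ uv]] ps].
move: vN; rewrite (nondominantE imf kerZ) // => /andP[vA v1].
apply: IH => //; apply: (subsetP (_ : <[u]> \subset _)); first by rewrite cycle_subG.
apply: prime_cycle_centralizer => //; last exact: (deep_commute uv).
by case/cycleP: ux => k ->; rewrite -expgM mulnC expgM -ox expg_order expg1n.
Qed.

End PrimeCase.

Theorem theorem5p27 (n : nat) (hn : 8 <= n)
  (hT : finGroupType) (E : {group hT})
  (f : {morphism E >-> {perm 'I_n}})
  (hf : schur_cover (Alt 'I_n) f) :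
  reduced_connected (Alt 'I_n) f <->
  (~~ prime n /\ ~~ prime (n - 1) /\ ~~ prime (n - 2)).
Proof.
have [[imf ker_sub] _] := hf.
have kerZ : 'ker f \subset 'Z(E) by apply: subset_trans ker_sub (subsetIl _ _).
split=> [conn|[n0 [n1 n2]]].
  (* The three numbers are [n - k] for [k] at most 2, and each is at least 6. *)
  have notprime k : k <= 2 -> ~~ prime (n - k).
    move=> k2; apply/negP=> pp; have kn : k <= n by apply: leq_trans k2 (leq_trans _ hn).
    have p2 : 2 < n - k.
      by apply: (@leq_trans (8 - 2)) => //; apply: leq_sub.
    apply: (prime_disconnected pp p2 _ imf kerZ _ _ conn); rewrite card_ord.
    - by rewrite -{1}(subnK kn) leq_add2l.
    - exact: leq_trans hn.
    - exact: leq_subr.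
  by split; [rewrite -(subn0 n)|split]; apply: notprime.
apply: (nonprime_connected imf kerZ); rewrite card_ord; last by split.
(* The values 8 and 9 are excluded because [8 - 1] and [9 - 2] equal the prime 7, so there are at
   least ten points. *)
move: n0 n1 n2; case: n hn {f hf imf ker_sub kerZ} => [|[|[|[|[|[|[|[|[|[|m]]]]]]]]]] //.
Qed.
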